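(* Let $\mathcal{U}$ be a non-trivial uniform structure on a non-empty set $X$. There exist a totally ordered set $\mathcal{I}$ with a zero and a pseudo uniform $\mathcal{I}$-metric $\mathbf{d}$ on $X$ with $\mathcal{U}=\mathcal{U}_{\mathbf{d}}$ if and only if there is a base $\mathcal{A}$ of $\mathcal{U}$ that is totally ordered by inclusion. In this case, we can take $\mathcal{I}=\overline{\mathcal{A}}$.
   Context: $\mathcal{P}_0(X\times X)$ is the collection of non-empty subsets of $X\times X$; $\Delta_X=\{(x,x):x\in X\}$; for $A,B\subseteq X\times X$, $A^{-1}=\{(y,x):(x,y)\in A\}$ and $A\circ B=\{(x,z):\exists y\in X,\ (x,y)\in A,\ (y,z)\in B\}$. A uniform structure on $X$ is a (non-empty) collection $\mathcal{U}\subseteq\mathcal{P}_0(X\times X)$ such that for all $U,V\in\mathcal{U}$ and $S\in\mathcal{P}_0(X\times X)$ with $U\subseteq S$ one has $\Delta_X\subseteq U$, $U\cap V,\,U^{-1},\,S\in\mathcal{U}$, and there is $W\in\mathcal{U}$ with $W\circ W\subseteq U$. A subcollection $\mathcal{B}\subseteq\mathcal{U}$ is a base for $\mathcal{U}$ if every $U\in\mathcal{U}$ contains some $V\in\mathcal{B}$. $\mathcal{U}$ is trivial if there is $U_0\in\mathcal{U}$ with $\mathcal{U}=\{U\subseteq X\times X:U_0\subseteq U\}$, and non-trivial otherwise. For $\mathcal{A}\subseteq\mathcal{P}_0(X\times X)$: $\mathcal{A}_{\mathrm{s}}=\{(A\cap A^{-1})\cup\Delta_X:A\in\mathcal{A}\}$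 and $\overline{\mathcal{A}}=\{\bigcap\mathcal{S}:\emptyset\ne\mathcal{S}\subseteq\mathcal{A}_{\mathrm{s}}\}$, ordered by inclusion. The zero of a partially ordered set $\mathcal{I}$ is its smallest element $0_{\mathcal{I}}$; $\mathcal{I}_\infty$ is $\mathcal{I}$ with a new element $\infty$ adjoined that is strictly larger than all elements of $\mathcal{I}$. A D-index set is a partially ordered set $\mathcal{I}$ with a zero such that $\mathcal{I}\setminus\{0_{\mathcal{I}}\}$ is non-empty and downward directed. For $\mathbf{d}:X\times X\to\mathcal{I}_\infty$ and $\alpha\in\mathcal{I}$, $\mathbf{D}_\alpha=\{(x,y)\in X\times X:\mathbf{d}(x,y)\le\alpha\}$. A pseudo uniform $\mathcal{I}$-metric (which presupposes that $\mathcal{I}$ is a D-index set) is a map $\mathbf{d}:X\times X\to\mathcal{I}_\infty$ with $\mathbf{d}(x,x)=0_{\mathcal{I}}$ and $\mathbf{d}(x,y)=\mathbf{d}(y,x)$ for all $x,y$, such that there is $\Psi:\mathcal{I}\setminus\{0_{\mathcal{I}}\}\to\mathcal{I}\setminus\{0_{\mathcal{I}}\}$ with $\mathbf{D}_{\Psi(\beta)}\circ\mathbf{D}_{\Psi(\beta)}\subseteq\mathbf{D}_\beta$ for all $\beta\in\mathcal{I}\setminus\{0_{\mathcal{I}}\}$. $\mathcal{U}_{\mathbf{d}}$ is the uniform structure having $\{\mathbf{D}_\alpha:\alpha\in\mathcal{I}\setminus\{0_{\mathcal{I}}\}\}$ as a base. *)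

(* Defs.v *)
From HB Require Import structures.
From mathcomp Require Import all_boot all_order.
From mathcomp Require Import all_classical.
From mathcomp Require Export uniform_structure.

Set Implicit Arguments.
Unset Strict Implicit.
Unset Printing Implicit Defensive.

Import Order.TTheory.
Local Open Scope classical_set_scope.
Local Open Scope order_scope.

Section UniformStructures.
Variable X : Type.
Implicit Types (U A : set_system (X * X)).

Definition uniform_base A U : Prop :=
  A `<=` U /\ forall V, U V -> exists2 B, A B & B `<=` V.

Definition trivial_uniformity U : Prop :=
  exists2 U0, U U0 & U = [set V | U0 `<=` V].

Definition sym_family A : set_system (X * X) :=
  [set (B `&` B^-1%relation) `|` diagonal | B in A].

Definition inter_closure A : set_system (X * X) :=
  [set \bigcap_(B in S) B | S in [set S | S !=set0 /\ S `<=` sym_family A]].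

End UniformStructures.

(* The subtype of set (X * X) carried by inter_closure A, with the order
   inherited from set (X * X), namely inclusion. *)
Definition inter_closure_type (X : Type) (A : set_system (X * X)) : Type :=
  set_type (inter_closure A).

HB.instance Definition _ (X : Type) (A : set_system (X * X)) :=
  SubChoice.copy (inter_closure_type A) {B | B \in inter_closure A}.

HB.instance Definition _ (X : Type) (A : set_system (X * X)) :=
  [SubChoice_isSubPOrder of inter_closure_type A by <: with set_display].

Lemma le_inter_closureE (X : Type) (A : set_system (X * X))
    (a b : inter_closure_type A) :
  a <= b <-> \val a `<=` \val b.
Proof. by rewrite -subsetEset Order.le_val. Qed.

Section IndexedMetrics.
Variables (disp : Order.disp_t) (I : porderType disp) (z : I).

Definition is_zero : Prop := forall a : I, z <= a.

Definition D_index_set : Prop :=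
  [/\ is_zero,
      exists a : I, a != z &
      forall a b : I, a != z -> b != z ->
        exists c : I, [/\ c != z, c <= a & c <= b]].

(* The order on I with a top element adjoined, the latter encoded by None. *)
Definition le_infty (u v : option I) : bool :=
  match u, v with
  | _, None => true
  | None, Some _ => false
  | Some a, Some b => a <= b
  end.

Variable X : Type.
Implicit Type d : X -> X -> option I.

Definition dball d (a : I) : set (X * X) :=
  [set xy | le_infty (d xy.1 xy.2) (Some a)].

Definition pseudo_uniform_metric d : Prop :=
  [/\ D_index_set,
      forall x, d x x = Some z,
      forall x y, d x y = d y x &
      exists2 Psi : I -> I,
        (forall b, b != z -> Psi b != z) &
        forall b, b != z ->
          (dball d (Psi b) \; dball d (Psi b) `<=` dball d b)%relation].

Definition metric_uniformity d : set_system (X * X) :=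
  filter_from [set a | a != z] (dball d).

Lemma metric_uniformity_base d :
  uniform_base [set dball d a | a in [set a | a != z]] (metric_uniformity d).
Proof.
split=> [_ [a az <-]|V [a az aV]]; first by exists a.
by exists (dball d a) => //; exists a.
Qed.

Lemma metric_uniformityP d : pseudo_uniform_metric d ->
  [/\ Filter (metric_uniformity d),
      forall V, metric_uniformity d V -> diagonal `<=` V,
      forall V, metric_uniformity d V -> metric_uniformity d V^-1%relation &
      forall V, metric_uniformity d V ->
        exists2 W, metric_uniformity d W & (W \; W `<=` V)%relation].
Proof.
move=> [[z0 [a0 a0z] dir] dxx dC [Psi Psiz PsiD]]; split.
- apply: filter_from_filter; first by exists a0.
  move=> a b az bz; have [c [cz ca cb]] := dir _ _ az bz.
  exists c => // -[x y]; rewrite /dball /=.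
  by case: (d x y) => //= e ec; split; rewrite /= (le_trans ec).
- move=> V [a _ aV] [x y] /= /diagonalP <-; apply: aV.
  by rewrite /dball /= dxx /=; exact: z0.
- move=> V [a az aV]; exists a => // -[x y] /= xy; apply: aV.
  by rewrite /dball /= dC.
- move=> V [b bz bV]; exists (dball d (Psi b)).
    by exists (Psi b) => //; exact: Psiz.
  by apply: subset_trans bV; exact: PsiD.
Qed.

Definition totally_metrized_by (U : set_system (X * X)) : Prop :=
  [/\ total (<=%O : rel I), is_zero &
      exists2 d, pseudo_uniform_metric d & U = metric_uniformity d].

End IndexedMetrics.

(* Main.v *)
Require Import Defs.
From mathcomp Require Import all_boot all_order.
From mathcomp Require Import all_classical.
From mathcomp Require Import uniform_structure.

Set Implicit Arguments.
Unset Strict Implicit.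
Unset Printing Implicit Defensive.

Import Order.TTheory.
Local Open Scope classical_set_scope.

(** If the index set is totally ordered, its balls form a chain, and by
    definition they are a base of the metric uniformity: this is the easy half
    ([metrized_chain_base]).

    Conversely, let [A] be a base that is a chain.  Symmetrizing keeps it a
    chain of entourages, and intersections of members of a chain again form a
    chain, so the closure of [A] is totally ordered, with the intersection [z]
    of the whole uniformity as its zero.  Since the closure is stable under
    intersections, the members that contain a given pair [(x, y)], if there are
    any, have a least one; taking it as the distance from [x] to [y] makes the
    ball of radius [a] equal to the relation [a] itself
    ([inter_closure_dist]).

    What remains is to see that the nonzero members of the closure form a base.
    A member [a] other than [z] is not contained in all symmetrized members of
    [A], hence by totality it contains one of them ([chain_below_nonzero]) and
    is an entourage.  Conversely, [z] itself is not an entourage: otherwise it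
    would be the least one and the uniformity would be trivial.  So the members
    of the symmetrized base are all nonzero, and they are small enough. *)

Section IndexOrder.
Context {disp : Order.disp_t} {I : porderType disp}.

(** The indices above a value determine that value, infinity being the only one
    with none above it; thus a generalized metric is known from its balls. *)
Lemma eq_le_infty (u v : option I) :
  (forall a, le_infty u (Some a) = le_infty v (Some a)) -> u = v.
Proof.
case: u => [b|]; case: v => [c|] //= uv.
- by congr Some; apply: le_anti; rewrite -uv lexx uv lexx.
- by have := uv b; rewrite lexx.
- by have := uv c; rewrite lexx.
Qed.

Lemma dball_subset {X : Type} (d : X -> X -> option I) (a b : I) :
  (a <= b)%O -> dball d a `<=` dball d b.
Proof.
move=> ab [x y]; rewrite /dball /=.
by case: (d x y) => //= c ca; apply: le_trans ab.
Qed.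

(** A ball of nonzero radius is already a member of the base of balls, and
    comparing radii compares balls. *)
Lemma metrized_chain_base {X : Type} (z : I) (U : set_system (X * X)) :
  totally_metrized_by z U ->
  exists A, uniform_base A U /\ total_on A subset.
Proof.
move=> [tot _ [d _ ->]]; eexists; split; first exact: metric_uniformity_base.
move=> _ _ [a _ <-] [b _ <-].
by case/orP: (tot a b) => ab; [left|right]; apply: dball_subset.
Qed.

End IndexOrder.

Section InterClosure.
Context {X : Type} {A : set_system (X * X)}.
Implicit Types (a z : inter_closure_type A).

Lemma sym_family_sym B x y : sym_family A B -> B (x, y) -> B (y, x).
Proof.
by move=> [C _ <-] [[/= Cxy Cyx]|/diagonalP ->]; [left|right].
Qed.

Lemma sym_family_refl B x : sym_family A B -> B (x, x).
Proof. by move=> [C _ <-]; right. Qed.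

Lemma inter_closure_bigcap (S : set_system (X * X)) :
  S !=set0 -> S `<=` sym_family A ->
  exists a : inter_closure_type A, \val a = \bigcap_(B in S) B.
Proof.
move=> S0 SA.
have aP : (\bigcap_(B in S) B) \in inter_closure A by apply/mem_set; exists S.
by exists (Sub (\bigcap_(B in S) B) aP).
Qed.

Lemma inter_closureP a :
  exists S, [/\ S !=set0, S `<=` sym_family A & \val a = \bigcap_(B in S) B].
Proof. by case: a => B /= /[dup] /set_mem[S [S0 SA] <-] _; exists S. Qed.

Lemma sub_inter_closure B : sym_family A B ->
  exists a : inter_closure_type A, \val a = B.
Proof.
move=> AB; have [||a aB] := @inter_closure_bigcap [set B]; first by exists B.
  by move=> _ ->.
by exists a; rewrite aB bigcap_set1.
Qed.

Lemma inter_closure_sym a x y : \val a (x, y) -> \val a (y, x).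
Proof.
have [S [_ SA ->]] := inter_closureP a => axy B SB.
by apply: (sym_family_sym (SA _ SB)); apply: axy.
Qed.

Lemma inter_closure_refl a x : \val a (x, x).
Proof.
have [S [_ SA ->]] := inter_closureP a => B SB.
by apply: sym_family_refl; exact: SA.
Qed.

Lemma sym_family_total :
  total_on A subset -> total_on (sym_family A) subset.
Proof.
move=> totA _ _ [B AB <-] [C AC <-].
have symS (D E : set (X * X)) : D `<=` E ->
    (D `&` D^-1%relation) `|` diagonal `<=` (E `&` E^-1%relation) `|` diagonal.
  by move=> DE; apply: setSU => -[x y] [/DE Exy /DE Eyx].
by have [BC|CB] := totA _ _ AB AC; [left|right]; exact: symS.
Qed.

(** A member of one family that does not contain the intersection of the other
    family contains none of its members either, hence lies below all of them and
    below their intersection. *)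
Lemma inter_closure_total : total_on A subset ->
  total (<=%O : rel (inter_closure_type A)).
Proof.
move=> /sym_family_total totA a b.
have [ab|ab] := pselect (\val a `<=` \val b).
  by apply/orP; left; apply/le_inter_closureE.
apply/orP; right; apply/le_inter_closureE; move: ab.
have [S [_ SA ->]] := inter_closureP a.
have [T [_ TA ->]] := inter_closureP b => nST p Tp B SB.
apply: contrapT => nBp; apply: nST => q Sq C TC.
have [BC|CB] := totA _ _ (SA _ SB) (TA _ TC); first exact: BC _ (Sq _ SB).
by case: nBp; exact: CB _ (Tp _ TC).
Qed.

Lemma inter_closure_zero z :
  \val z = \bigcap_(B in sym_family A) B -> is_zero z.
Proof.
move=> zE a; apply/le_inter_closureE; rewrite zE.
by have [S [_ SA ->]] := inter_closureP a => p Ap B /SA; exact: Ap.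
Qed.

(** Totality is what excludes that [a] is incomparable to every member: being
    nonzero, [a] fails to be contained in one of them, and so contains it. *)
Lemma chain_below_nonzero z a : total_on A subset ->
  \val z = \bigcap_(B in sym_family A) B -> a != z ->
  exists2 B, sym_family A B & B `<=` \val a.
Proof.
move=> /inter_closure_total tot zE az.
have /existsNP[B /not_implyP[AB naB]] :
    ~ (forall B, sym_family A B -> \val a `<=` B).
  move=> aA; move/eqP: az; apply; apply: le_anti.
  rewrite (inter_closure_zero zE) andbT; apply/le_inter_closureE.
  by rewrite zE => p ap B AB; exact: aA ap.
have [b bB] := sub_inter_closure AB; exists B => //; rewrite -bB.
apply/le_inter_closureE; have /orP[/le_inter_closureE|//] := tot a b.
by rewrite bB.
Qed.

(** The distance from [x] to [y] is the intersection of all members containing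
    [(x, y)], or infinity if no member does. *)
Lemma inter_closure_dist :
  exists d : X -> X -> option (inter_closure_type A),
    forall a, dball d a = \val a.
Proof.
suff /choice[f fP] : forall p : X * X,
    exists u : option (inter_closure_type A),
      forall a, le_infty u (Some a) <-> \val a p.
  exists (fun x y => f (x, y)) => a.
  by apply/seteqP; split=> -[x y] /fP.
move=> p; have [pA|npA] := pselect ([set B | sym_family A B /\ B p] !=set0).
  have [|m mE] := inter_closure_bigcap pA; first by move=> B [].
  exists (Some m) => a /=; split=> [/le_inter_closureE|].
    by apply; rewrite mE => B [].
  have [S [_ SA aE]] := inter_closureP a => ap.
  apply/le_inter_closureE; rewrite mE aE => q mq B SB; apply: mq.
  by split; [exact: SA|move: ap; rewrite aE; exact].
exists None => a; split=> //= ap; case: npA; move: ap.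
have [S [[B SB] SA ->]] := inter_closureP a => Sp.
by exists B; split; [exact: SA|exact: Sp].
Qed.

End InterClosure.

Section ChainBase.
Context {X : uniformType} {A : set_system (X * X)}.
Context (baseA : uniform_base A (@entourage X)).

Lemma sym_family_entourage B : sym_family A B -> entourage B.
Proof.
move=> [C /(proj1 baseA) /entourage_invI CE <-].
by apply: filterS CE => p; left.
Qed.

Lemma sym_family_small V :
  entourage V -> exists2 B, sym_family A B & B `<=` V.
Proof.
move=> VE; have [C AC CV] := proj2 baseA _ VE.
exists ((C `&` C^-1%relation) `|` diagonal); first by exists C.
move=> [x y] [[/CV]//|/diagonalP ->]; exact: entourage_refl.
Qed.

(** The intersection of a nontrivial uniformity is not an entourage, for it
    would generate the uniformity. *)
Lemma bigcap_sym_family_not_entourage :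
  ~ trivial_uniformity (@entourage X) ->
  ~ entourage (\bigcap_(B in sym_family A) B).
Proof.
move=> ntU zE; apply: ntU; exists (\bigcap_(B in sym_family A) B) => //.
apply/seteqP; split=> V; last by move=> zV; exact: filterS zE.
by move=> /sym_family_small[B AB BV] p zp; exact: BV _ (zp _ AB).
Qed.

Lemma chain_base_metrized :
  ~ trivial_uniformity (@entourage X) -> total_on A subset ->
  exists z : inter_closure_type A, totally_metrized_by z (@entourage X).
Proof.
move=> /bigcap_sym_family_not_entourage nzE totA.
have [B0 AB0 _] := sym_family_small entourageT.
have [||z zE] := @inter_closure_bigcap _ A (sym_family A) => //.
  by exists B0.
have z0 := inter_closure_zero zE.
have tot := inter_closure_total totA.
have nzP (a : inter_closure_type A) : a != z <-> entourage (\val a).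
  split=> [/(chain_below_nonzero totA zE)[B /sym_family_entourage BE Ba]|aE].
    exact: filterS BE.
  by apply/eqP => az; apply: nzE; rewrite -zE -az.
have small V : entourage V ->
    exists2 a : inter_closure_type A, a != z & \val a `<=` V.
  move=> /sym_family_small[B AB BV]; have [a aB] := sub_inter_closure AB.
  by exists a; rewrite ?aB//; apply/nzP; rewrite aB; exact: sym_family_entourage.
have [d dE] := @inter_closure_dist _ A.
have dP x y a : le_infty (d x y) (Some a) <-> \val a (x, y) by rewrite -dE.
exists z; split=> //; exists d; last first.
  apply/seteqP; split=> [V /small[a az aV]|V [a /= /nzP aE]].
    by exists a => //; rewrite dE.
  by rewrite dE => aV; exact: filterS aE.
split.
- split=> //; first by have [a az _] := small _ entourageT; exists a.
  by move=> a b az bz; have /orP[ab|ba] := tot a b; [exists a|exists b].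
- move=> x; apply: eq_le_infty => a.
  by rewrite /= z0; apply/dP; exact: inter_closure_refl.
- move=> x y; apply: eq_le_infty => a.
  by apply/idP/idP => /dP xy; apply/dP; exact: inter_closure_sym.
- (* The radii are relations: a half of [b] is a radius inside an entourage
     whose square is contained in [b]. *)
  have /choice[Psi PsiP] (b : inter_closure_type A) :
      exists c : inter_closure_type A,
        b != z -> c != z /\ (\val c \; \val c `<=` \val b)%relation.
    have [->|/nzP/entourage_split_ex[W /small[c cz cW] Wb]] := eqVneq b z.
      by exists z.
    exists c => _; split=> // -[x y] [t /= xt ty]; apply: Wb.
    by exists t; exact: cW.
  exists Psi => b bz; first by have [] := PsiP b bz.
  by rewrite !dE; have [] := PsiP b bz.
Qed.

End ChainBase.

Theorem corollary18 (X : uniformType) (X0 : [set: X] !=set0)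
    (ntU : ~ trivial_uniformity (@entourage X)) :
  ((exists (disp : Order.disp_t) (I : porderType disp) (z : I),
      totally_metrized_by z (@entourage X)) <->
   (exists A : set_system (X * X),
      uniform_base A (@entourage X) /\ total_on A subset)) /\
  (forall A : set_system (X * X),
     uniform_base A (@entourage X) -> total_on A subset ->
     exists z : inter_closure_type A, totally_metrized_by z (@entourage X)).
Proof.
split=> [|A baseA totA]; last exact: chain_base_metrized.
split=> [[disp [I [z]]]|[A [baseA totA]]]; first exact: metrized_chain_base.
have [z zU] := chain_base_metrized baseA ntU totA.
by exists set_display, (inter_closure_type A), z.
Qed.
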